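(* Let $\Gamma$ be a finite simple graph and let $\tilde\Gamma$ be the prime graph of $SEP(\Gamma)$. (1) If $\Gamma$ has exactly one structural equivalence class, of size $\alpha$, then $V(\tilde\Gamma)$ is the set of primes $\le\alpha$, and for distinct primes $p,q\in V(\tilde\Gamma)$, $pq\in E(\tilde\Gamma)$ if and only if $p+q\le\alpha$. (2) If $\Gamma$ has at least two structural equivalence classes, with $\alpha$ the size of a largest class and $\beta$ the size of a second largest class (i.e. the largest size among the remaining classes after removing one largest class), then $V(\tilde\Gamma)$ is the set of primes $\le\alpha$, and for primes $p>q$ in $V(\tilde\Gamma)$, $pq\in E(\tilde\Gamma)$ if and only if $p+q\le\alpha$, or $p\le\alpha$ and $q\le\beta$.
   Context: Two vertices $u,v$ of a graph $\Gamma$ are structurally equivalent if the transposition $(u\,v)$ (swapping $u,v$, fixing other vertices) is an automorphism of $\Gamma$; this is an equivalence relation whose classes are the structural equivalence classes. $SEP(\Gamma)=\langle\{(u\,v) : (u\,v)\in \mathrm{Aut}(\Gamma)\}\rangle$. The prime graph of a finite group $G$ is the graph whose vertices are the primes dividing $|G|$, with distinct primes $p,q$ adjacent iff $G$ contains an element of order $pq$. *)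

(* Defs.v *)
From HB Require Import structures.
From mathcomp Require Import all_boot all_fingroup.

Set Implicit Arguments.
Unset Strict Implicit.
Unset Printing Implicit Defensive.

Import GroupScope.

Record sgraph := SGraph {
  vertex :> finType;
  adj : rel vertex;
  adj_sym : symmetric adj;
  adj_irrefl : irreflexive adj
}.

Section StructuralEquivalence.
Variable G : sgraph.
Implicit Types (s : {perm G}) (u v w : G).

Definition graph_aut : {set {perm G}} :=
  [set s : {perm G} | [forall u, forall v, adj (s u) (s v) == adj u v]].

Lemma graph_autP s :
  reflect (forall u v, adj (s u) (s v) = adj u v) (s \in graph_aut).
Proof.
rewrite inE; apply: (iffP 'forall_forallP) => H u v; first exact/eqP.
exact/eqP.
Qed.

Lemma graph_aut_group_set : group_set graph_aut.
Proof.
apply/group_setP; split; first by apply/graph_autP => u v; rewrite !perm1.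
move=> s t /graph_autP Hs /graph_autP Ht; apply/graph_autP => u v.
by rewrite !permM Ht Hs.
Qed.
Canonical graph_aut_group := Group graph_aut_group_set.

(* Reflexive because [tperm u u = 1]. *)
Definition struct_equiv : rel G := [rel u v | tperm u v \in graph_aut].

Lemma struct_equiv_equivalence :
  {in [set: G] & &, equivalence_rel struct_equiv}.
Proof.
have sym u v : struct_equiv u v = struct_equiv v u by rewrite /struct_equiv /= tpermC.
have trans : transitive struct_equiv.
  rewrite /struct_equiv => v u w /= uv vw.
  have [->//|uNv] := eqVneq u v; have [->|uNw] := eqVneq u w.
    by rewrite tperm1 group1.
  have <- : tperm u v ^ tperm v w = tperm u w.
    by rewrite tpermJ tpermL tpermD // eq_sym.
  by rewrite groupJ.
move=> u v w _ _ _; split; first by rewrite /struct_equiv /= tperm1 group1.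
by move=> uv; apply/idP/idP; apply: trans; rewrite // sym.
Qed.

Definition struct_classes : {set {set G}} :=
  equivalence_partition struct_equiv [set: G].

Definition aut_transpositions : {set {perm G}} :=
  [set tperm u v | u in [set: G], v in [set: G] & tperm u v \in graph_aut].

Definition SEP : {group {perm G}} := <<aut_transpositions>>%G.

End StructuralEquivalence.

Definition largest_in (T : finType) (P : {set {set T}}) (A : {set T}) : Prop :=
  A \in P /\ (forall C : {set T}, C \in P -> #|C| <= #|A|).

Section PrimeGraph.
Variables (gT : finGroupType) (H : {group gT}).

Definition prime_vertex : finType := seq_sub (primes #|H|).

Definition prime_adj : rel prime_vertex :=
  [rel p q | (p != q) && [exists x in H, #[x] == (ssval p * ssval q)%N]].

Lemma prime_adj_sym : symmetric prime_adj.
Proof.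
move=> p q; rewrite /prime_adj /= eq_sym; congr (_ && _).
by apply: eq_existsb => x; rewrite mulnC.
Qed.

Lemma prime_adj_irrefl : irreflexive prime_adj.
Proof. by move=> p; rewrite /prime_adj /= eqxx. Qed.

Definition prime_graph : sgraph := SGraph prime_adj_sym prime_adj_irrefl.

Definition prime_of (p : prime_graph) : nat := ssval (p : prime_vertex).

End PrimeGraph.

(* Main.v *)
Require Import Defs.
From Corelib Require Import Setoid.
From HB Require Import structures.
From mathcomp Require Import all_boot all_fingroup.
From mathcomp Require Import cyclic pgroup.

(* Structural equivalence is transitive, so SEP(G) consists of all permutations
   mapping each vertex into its own structural equivalence class: it is the
   direct product of the symmetric groups on the classes. A prime divides the
   order of a permutation only if it divides the length of one of its cycles,
   and each cycle stays inside a class; hence an element of order p q yields a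
   cycle of length divisible by p and one of length divisible by q, which are
   disjoint or share a single cycle of length at least p q >= p + q.
   Conversely, disjoint sets of p and q vertices inside classes carry commuting
   permutations of orders p and q. *)

Set Implicit Arguments.
Unset Strict Implicit.
Unset Printing Implicit Defensive.

Import GroupScope.

(** * Cycle lengths and permutations of prime order *)

Lemma leq_add_mul (m n : nat) : 1 < m -> 1 < n -> m + n <= m * n.
Proof.
wlog le_mn : m n / m <= n => [IH m_gt1 n_gt1 | m_gt1 _].
  by case/orP: (leq_total m n) => /IH; [|rewrite addnC mulnC]; apply.
apply: (@leq_trans (2 * n)); first by rewrite mul2n -addnn leq_add2r.
by rewrite leq_mul2r m_gt1 orbT.
Qed.

Lemma exists_subset_card (T : finType) (A : {set T}) (n : nat) :
  n <= #|A| -> exists2 S : {set T}, S \subset A & #|S| = n.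
Proof.
case/card_geqP => s [s_uniq s_size sA]; exists [set x in s].
  by apply/subsetP => x; rewrite inE => /sA.
by rewrite cardsE (card_uniqP s_uniq).
Qed.

Lemma prime_dvd_order_porbit (T : finType) (s : {perm T}) (p : nat) :
  prime p -> p %| #[s] -> exists u, p %| #|porbit s u|.
Proof.
move=> p_pr p_dvd.
(* The product of the cycle lengths, taken over all points and so with repetitions, is an exponent
   of [s]. Hence [#[s]] divides it, and Euclid's lemma singles out one factor. *)
have : p %| \prod_(u : T) #|porbit s u|.
  apply: dvdn_trans p_dvd _; rewrite order_dvdn; apply/eqP/permP => u.
  rewrite perm1 (bigD1 u) //= expgM permX_fix // permX.
  exact: iter_porbit.
rewrite Euclid_dvd_prod // big_has => /hasP[u _ pu].
by exists u.
Qed.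

(** Cauchy's theorem in the symmetric group on [S], whose order is [p!], spares the construction of
    an explicit [p]-cycle. *)
Lemma Sym_elt_prime_order (T : finType) (S : {set T}) (p : nat) :
  prime p -> #|S| = p -> exists2 s : {perm T}, perm_on S s & #[s] = p.
Proof.
move=> p_pr cardS.
have [|s sS ords] := @Cauchy _ p [group of perm.Sym S] p_pr.
  by rewrite perm.card_Sym cardS dvdn_fact // prime_gt0 /=.
by exists s => //; move: sS; rewrite inE.
Qed.

(** * Elements of [SEP G] and their cycles inside classes *)

Section StructuralEquivalencePermutations.
Variable G : sgraph.
Implicit Types (s : {perm G}) (u v : G) (C D S : {set G}) (p q : nat).

Lemma struct_equiv_refl u : struct_equiv u u.
Proof. by rewrite /struct_equiv /= tperm1 group1. Qed.

Lemma struct_equiv_sym u v : struct_equiv u v = struct_equiv v u.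
Proof. by rewrite /struct_equiv /= tpermC. Qed.

Lemma struct_equiv_trans u v w :
  struct_equiv u v -> struct_equiv v w -> struct_equiv u w.
Proof.
have T := in_setT; have [_ tr] := struct_equiv_equivalence (T _ u) (T _ v) (T _ w).
by move/tr ->.
Qed.

Lemma struct_classes_partition : partition (struct_classes G) [set: G].
Proof. exact: equivalence_partitionP (@struct_equiv_equivalence G). Qed.

Lemma pblock_struct_class u : pblock (struct_classes G) u \in struct_classes G.
Proof. by rewrite pblock_mem // (cover_partition struct_classes_partition). Qed.

Lemma mem_pblock_struct_classes u v :
  (v \in pblock (struct_classes G) u) = struct_equiv u v.
Proof.
exact: (pblock_equivalence_partition (@struct_equiv_equivalence G)).
Qed.

Lemma mem_struct_class C u v :
  C \in struct_classes G -> u \in C -> (v \in C) = struct_equiv u v.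
Proof.
have /and3P[_ tI _] := struct_classes_partition.
by move=> CP uC; rewrite -mem_pblock_struct_classes (def_pblock tI CP uC).
Qed.

Lemma disjoint_struct_classes C D :
  C \in struct_classes G -> D \in struct_classes G -> C != D ->
  [disjoint C & D].
Proof.
by have /and3P[_ /trivIsetP tI _] := struct_classes_partition; apply: tI.
Qed.

Lemma SEP_struct_equiv s u : s \in SEP G -> struct_equiv u (s u).
Proof.
(* [K] collects the permutations preserving every class. Transitivity makes it a group, so it
   suffices that it contains the generating transpositions. *)
pose K := [set t : {perm G} | [forall v, struct_equiv v (t v)]].
have KP (t : {perm G}) : reflect (forall v, struct_equiv v (t v)) (t \in K).
  by rewrite inE; exact: forallP.
have K_group : group_set K.
  apply/group_setP; split; first by apply/KP => v; rewrite perm1 struct_equiv_refl.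
  move=> t t' /KP Kt /KP Kt'; apply/KP => v; rewrite permM.
  exact: struct_equiv_trans (Kt v) (Kt' _).
suff sub : SEP G \subset Group K_group by move/(subsetP sub)/KP.
rewrite gen_subG; apply/subsetP => _ /imset2P[a b _ /setIdP[_ ab] ->].
apply/KP => v; case: tpermP => [-> | -> | _ _] //.
- by rewrite struct_equiv_sym.
- exact: struct_equiv_refl.
Qed.

Lemma tperm_SEP u v : struct_equiv u v -> tperm u v \in SEP G.
Proof.
by move=> uv; apply/mem_gen/imset2P; exists u v => //; apply/setIdP.
Qed.

(* Multiplying [s] by the transposition of [s u] and [u] fixes [u] and keeps
   all fixed points of [s]. *)
Lemma struct_equiv_SEP s : (forall u, struct_equiv u (s u)) -> s \in SEP G.
Proof.
(* Induction on the number of moved vertices. *)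
have [n] := ubnP #|[set u | s u != u]|; elim: n s => // n IHn s.
rewrite ltnS => les s_equiv.
have [/existsP[u su_neq] | ] := boolP [exists u, s u != u]; last first.
  rewrite negb_exists => /forallP s_fix.
  suff -> : s = 1 by exact: group1.
  by apply/permP => u; rewrite perm1; apply/eqP; rewrite -[_ == _]negbK.
set t := tperm (s u) u.
have tS : t \in SEP G by apply: tperm_SEP; rewrite struct_equiv_sym.
rewrite -(groupMr _ tS); apply: IHn => [|v]; last first.
  by rewrite permM; apply: struct_equiv_trans (s_equiv v) (SEP_struct_equiv _ tS).
apply: leq_trans les; apply/proper_card/properP; split; last first.
  by exists u; rewrite !inE ?permM ?tpermL ?eqxx.
apply/subsetP => v; rewrite !inE permM; apply: contra => /eqP sv.
(* A fixed point [v] of [s] is neither [u] nor, by injectivity of [s], equal to [s u]. *)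
rewrite sv tpermD //; apply: contraNneq su_neq; last by move=> ->; rewrite sv.
by rewrite -[in X in X -> _]sv => /perm_inj->; rewrite sv.
Qed.

Lemma perm_on_SEP C S s :
  C \in struct_classes G -> S \subset C -> perm_on S s -> s \in SEP G.
Proof.
move=> CP SC sS; apply: struct_equiv_SEP => u.
have [uS | uNS] := boolP (u \in S); last first.
  by rewrite (out_perm sS) ?struct_equiv_refl.
by rewrite -(mem_struct_class _ CP) (subsetP SC) // perm_closed.
Qed.

Lemma porbit_sub_struct_class s u :
  s \in SEP G -> porbit s u \subset pblock (struct_classes G) u.
Proof.
move=> sS; apply/subsetP => _ /porbitP[i ->].
by rewrite mem_pblock_struct_classes SEP_struct_equiv // groupX.
Qed.

(** Determines the vertices of the prime graph. By Cauchy's theorem a prime divisor [p] is the order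
    of an element, which has a cycle of length divisible by [p] inside one class; conversely [p]
    vertices of a class carry a permutation of order [p]. *)
Lemma prime_dvd_card_SEP p :
  prime p ->
  p %| #|SEP G| <-> (exists2 C, C \in struct_classes G & p <= #|C|).
Proof.
move=> p_pr; split.
  case/(Cauchy p_pr) => s sS ords.
  have [|u pu] := @prime_dvd_order_porbit _ s p p_pr; first by rewrite ords.
  exists (pblock (struct_classes G) u); first exact: pblock_struct_class.
  apply: leq_trans (subset_leq_card (porbit_sub_struct_class u sS)).
  by rewrite dvdn_leq // lt0n card_porbit_neq0.
case=> C CP /exists_subset_card[S SC cardS].
have [s sS <-] := Sym_elt_prime_order p_pr cardS.
exact/order_dvdG/(perm_on_SEP CP SC).
Qed.

(** [C] and [D] host the cycles for [p] and [q]. They may coincide, and the last clause then asks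
    for room for both. *)
Lemma SEP_order_mul_primes p q :
  prime p -> prime q -> p != q ->
  (exists2 s, s \in SEP G & #[s] = (p * q)%N) <->
  (exists C D, [/\ C \in struct_classes G, D \in struct_classes G,
     p <= #|C|, q <= #|D| & C = D -> p + q <= #|C|]).
Proof.
move=> p_pr q_pr pq_neq.
have cop : coprime p q by rewrite prime_coprime // dvdn_prime2.
split=> [[s sS ords] | [C [D [CP DP pC qD pqC]]]].
  have [|u pu] := @prime_dvd_order_porbit _ s p p_pr;
    first by rewrite ords dvdn_mulr.
  have [|v qv] := @prime_dvd_order_porbit _ s q q_pr;
    first by rewrite ords dvdn_mull.
  have orbC w := subset_leq_card (porbit_sub_struct_class w sS).
  have orb0 w : 0 < #|porbit s w| by rewrite lt0n card_porbit_neq0.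
  exists (pblock (struct_classes G) u), (pblock (struct_classes G) v).
  split; try exact: pblock_struct_class.
  - exact: leq_trans (dvdn_leq (orb0 u) pu) (orbC u).
  - exact: leq_trans (dvdn_leq (orb0 v) qv) (orbC v).
  move=> eqC; have [uv | uv] := eqVneq (porbit s u) (porbit s v).
    (* By coprimality [p * q] divides the length of the common cycle. *)
    apply: leq_trans (orbC u); apply: leq_trans (_ : p * q <= _).
      exact: leq_add_mul (prime_gt1 p_pr) (prime_gt1 q_pr).
    by rewrite dvdn_leq // Gauss_dvd // pu uv.
  have dis : [disjoint porbit s u & porbit s v].
    apply/pred0P => w /=; apply: contraNF uv => /andP[].
    by rewrite -!eq_porbit_mem => /eqP<- /eqP<-.
  apply: leq_trans (_ : #|porbit s u :|: porbit s v| <= _).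
    by rewrite cardsU disjoint_setI0 // cards0 subn0 leq_add // dvdn_leq.
  by apply: subset_leq_card; rewrite subUset {2}eqC !porbit_sub_struct_class.
have [S [T [SC TD cardS cardT dis]]] : exists S T : {set G},
    [/\ S \subset C, T \subset D, #|S| = p, #|T| = q & [disjoint S & T]].
  have [S SC cardS] := exists_subset_card pC.
  have [eqCD | neqCD] := eqVneq C D.
    (* Within a single class, [T] is drawn from what [S] leaves over, at least [q] vertices. *)
    have [|T] := @exists_subset_card _ (C :\: S) q.
      by rewrite cardsD (setIidPr SC) cardS -(leq_add2l p) subnKC // pqC.
    rewrite subsetD => /andP[TC dis] cardT.
    by exists S, T; rewrite -eqCD disjoint_sym.
  have [T TD cardT] := exists_subset_card qD.
  exists S, T; split=> //.
  exact/(disjointWl SC)/(disjointWr TD)/disjoint_struct_classes.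
have [s sS ords] := Sym_elt_prime_order p_pr cardS.
have [t tT ordt] := Sym_elt_prime_order q_pr cardT.
exists (s * t).
  by rewrite groupM ?(perm_on_SEP CP SC sS) ?(perm_on_SEP DP TD tT).
(* Disjoint supports make [s] and [t] commute, and their orders are coprime. *)
by rewrite orderM ?ords ?ordt //; apply: perm_onC dis.
Qed.

End StructuralEquivalencePermutations.

(** * Vertices and edges of a prime graph as arithmetic of the group *)

Section PrimeGraphOfGroup.
Variables (gT : finGroupType) (H : {group gT}).
Implicit Types p q : prime_graph H.

Lemma prime_of_inj : injective (@prime_of gT H).
Proof. exact: val_inj. Qed.

Lemma prime_of_prime p : prime (prime_of p).
Proof. by have := ssvalP (p : prime_vertex H); rewrite mem_primes => /and3P[]. Qed.

Lemma prime_ofP (n : nat) :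
  (exists p : prime_graph H, prime_of p = n) <-> prime n /\ n %| #|H|.
Proof.
have primesE : n \in primes #|H| = prime n && (n %| #|H|).
  by rewrite mem_primes cardG_gt0.
split=> [[p <-] | [n_pr n_dvd]].
  by have := ssvalP (p : prime_vertex H); rewrite mem_primes => /and3P[].
have n_in : n \in primes #|H| by rewrite primesE n_pr.
by exists (SeqSub n_in).
Qed.

Lemma prime_graph_adjP p q :
  p != q ->
  adj p q <-> (exists2 x, x \in H & #[x] = (prime_of p * prime_of q)%N).
Proof.
move=> pq; split; first by case/andP=> _ /exists_inP[x xH /eqP]; exists x.
case=> x xH ordx; apply/andP; split=> //.
by apply/exists_inP; exists x => //; apply/eqP.
Qed.

End PrimeGraphOfGroup.

Theorem theorem3p1 (G : sgraph) :
  (forall (A : {set G}) (alpha : nat),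
     struct_classes G = [set A] -> #|A| = alpha ->
     (forall n : nat,
        (exists p : prime_graph (SEP G), prime_of p = n) <->
        (prime n /\ n <= alpha)) /\
     (forall p q : prime_graph (SEP G), p != q ->
        (adj p q <-> prime_of p + prime_of q <= alpha)))
  /\
  (1 < #|struct_classes G| ->
   forall (A B : {set G}) (alpha beta : nat),
     largest_in (struct_classes G) A -> #|A| = alpha ->
     largest_in (struct_classes G :\ A) B -> #|B| = beta ->
     (forall n : nat,
        (exists p : prime_graph (SEP G), prime_of p = n) <->
        (prime n /\ n <= alpha)) /\
     (forall p q : prime_graph (SEP G), prime_of q < prime_of p ->
        (adj p q <->
         (prime_of p + prime_of q <= alpha \/
          (prime_of p <= alpha /\ prime_of q <= beta))))).
Proof.
have adjP (p q : prime_graph (SEP G)) : prime_of p != prime_of q ->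
    adj p q <-> exists C D, [/\ C \in struct_classes G, D \in struct_classes G,
      prime_of p <= #|C|, prime_of q <= #|D|
      & C = D -> prime_of p + prime_of q <= #|C|].
  move=> pq;
  rewrite -(SEP_order_mul_primes _ (prime_of_prime p) (prime_of_prime q) pq).
  by apply: prime_graph_adjP; apply: contraNneq pq => ->.
have vertexP (A : {set G}) n : largest_in (struct_classes G) A ->
    (exists p : prime_graph (SEP G), prime_of p = n) <-> prime n /\ n <= #|A|.
  case=> AP Amax; rewrite prime_ofP; split=> -[n_pr nle]; split=> //.
    have [C CP nC] := (prime_dvd_card_SEP G n_pr).1 nle.
    exact: leq_trans nC (Amax C CP).
  by apply/(prime_dvd_card_SEP G n_pr); exists A.
split=> [A _ classesE <- | _ A B _ _ A_largest <- [BP Bmax] <-].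
  have A_largest : largest_in (struct_classes G) A.
    by rewrite classesE; split=> [|C /set1P->]; rewrite ?set11.
  split=> [n | p q pq]; first exact: vertexP.
  rewrite adjP ?(inj_eq (@prime_of_inj _ _)) // classesE; split.
    by case=> C [D [/set1P-> /set1P-> _ _]]; apply.
  (* The only class hosts both cycles. *)
  move=> le_pq; exists A, A; rewrite set11; split=> //.
    exact: leq_trans (leq_addr _ _) le_pq.
  exact: leq_trans (leq_addl _ _) le_pq.
split=> [n | p q lt_qp]; first exact: vertexP.
have [AP Amax] := A_largest; have /setD1P[BA BG] := BP.
have neq_pq : prime_of p != prime_of q by rewrite neq_ltn lt_qp orbT.
rewrite adjP //; split=> [[C [D [CP DP pC qD pqC]]] | [le_pq | [pA qB]]].
- have [eqCD | neqCD] := eqVneq C D.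
    by left; apply: leq_trans (pqC eqCD) (Amax C CP).
  right; split; first exact: leq_trans pC (Amax C CP).
  (* If [D] is not [A], then [B] bounds it. If [D] is [A], then [C] is among the remaining classes,
     and [q < p <= #|C| <= #|B|]; this is where the order of the two primes matters. *)
  have [eqDA | neqDA] := eqVneq D A; last first.
    by apply: leq_trans qD (Bmax D _); rewrite !inE neqDA.
  apply: leq_trans (ltnW lt_qp) (leq_trans pC (Bmax C _)).
  by rewrite !inE -eqDA neqCD.
- exists A, A; split=> //.
    exact: leq_trans (leq_addr _ _) le_pq.
  exact: leq_trans (leq_addl _ _) le_pq.
(* The larger prime goes into [A] and the smaller into [B]; the classes differ, so the clause on
   coinciding classes is vacuous. *)
- by exists A, B; split=> // eqAB; rewrite eqAB eqxx in BA.
Qed.
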